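(* Let $m\in\mathbb{N}$. There exists a constant $C_m>0$, depending only on $m$, such that for all real $p,q$ with $0<q<p\le1$, all $n\in\mathbb{N}$ and all $x\in[0,1]$, $$\left|B_{n,p,q}\left((t-x)_{p,q}^m;x\right)\right|\le C_m\,\frac{x(1-x)}{[n]^{\lfloor\frac{m+1}{2}\rfloor}}.$$
   Context: For $0<q<p\le1$ and integers $n\ge0$, $[n]=[n]_{p,q}=\frac{p^n-q^n}{p-q}$, $[n]!=[n]_{p,q}!=\prod_{j=1}^n[j]$ (with $[0]!=1$), and $\left[{n\atop k}\right]_{p,q}=\frac{[n]!}{[k]!\,[n-k]!}$. Put $$P_{n,k}(p,q;x)=p^{\frac{k(k-1)}{2}}\left[{n\atop k}\right]_{p,q}x^k\prod_{s=0}^{n-k-1}(p^s-q^sx).$$ The $(p,q)$-Bernstein operator is $$B_{n,p,q}(f;x)=\frac{1}{p^{\frac{n(n-1)}{2}}}\sum_{k=0}^n f\!\left(\frac{[k]}{p^{k-n}[n]}\right)P_{n,k}(p,q;x).$$ The $(p,q)$-power is $(t-x)_{p,q}^m=\prod_{s=0}^{m-1}(p^st-q^sx)$. In $B_{n,p,q}((t-x)_{p,q}^m;x)$ the operator acts on the variable $t$: $t$ is replaced by $\frac{[k]}{p^{k-n}[n]}$ in the $k$-th summand. $\lfloor a\rfloor$ denotes the integer part of $a$. *)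

(* Defs.v *)
From HB Require Import structures.
From mathcomp Require Import all_boot all_order all_algebra.
From mathcomp Require Import reals.

Set Implicit Arguments.
Unset Strict Implicit.
Unset Printing Implicit Defensive.

Import Order.TTheory GRing.Theory Num.Theory.

Local Open Scope ring_scope.

Definition pq_nat (R : realType) (p q : R) (n : nat) : R :=
  (p ^+ n - q ^+ n) / (p - q).

Definition pq_fact (R : realType) (p q : R) (n : nat) : R :=
  \prod_(1 <= j < n.+1) pq_nat p q j.

Definition pq_binom (R : realType) (p q : R) (n k : nat) : R :=
  pq_fact p q n / (pq_fact p q k * pq_fact p q (n - k)).

Definition pq_bernstein_basis (R : realType) (p q : R) (n k : nat) (x : R) : R :=
  p ^+ ((k * k.-1) %/ 2) * pq_binom p q n k * x ^+ k *
    \prod_(0 <= s < n - k) (p ^+ s - q ^+ s * x).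

(* The exponent [k - n] of [p] in the nodes is a nonpositive integer. *)
Definition pq_bernstein (R : realType) (p q : R) (n : nat) (f : R -> R) (x : R) : R :=
  (p ^+ ((n * n.-1) %/ 2))^-1 *
    \sum_(0 <= k < n.+1)
      f (pq_nat p q k / (p ^ (k%:Z - n%:Z) * pq_nat p q n)) *
      pq_bernstein_basis p q n k x.

(* The (p,q)-power (t - x)_{p,q}^m; it is not a function of [t - x] alone. *)
Definition pq_power (R : realType) (p q : R) (m : nat) (t x : R) : R :=
  \prod_(0 <= s < m) (p ^+ s * t - q ^+ s * x).

(* Main.v *)
Require Import Defs.
From mathcomp Require Import all_boot all_order all_algebra.
From mathcomp Require Import reals.
From mathcomp Require Import ring lra zify.

Set Implicit Arguments.
Unset Strict Implicit.
Unset Printing Implicit Defensive.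

Import Order.TTheory GRing.Theory Num.Theory.

Local Open Scope ring_scope.

(** After rescaling, the (p,q)-operator is the q-operator with q replaced by
    q/p, and the (p,q)-power only gains the factor p^(m(m-1)/2) <= 1; since
    [n]_{p,q} <= [n]_{q/p}, it suffices to treat p = 1.  There put
    T_m(x) = B_n((t-x)_q^m; x) and S_m(x) = B_n((t-qx)_q^m; x).  The q-difference
    equation of the basis gives
      (1-q)[n] T_{m+1}(x) = (1-x) (S_m(x) - T_m(qx)),
      S_{m+1}(x) = T_{m+1}(x) + (1-q^(m+1)) x S_m(x),
    hence T_{m+2} = x(1-x)/[n] * (D_q T_{m+1} + [m+1] S_m).  As 1-q <= 1/[n],
    induction shows that T_m, S_m and T_{m+1}/(x(1-x)) are polynomials of
    degree bounded in terms of m, whose coefficients are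
    O([n]^(-floor((m+1)/2))) for T_m and S_m and O([n]^(-floor((m+2)/2))) for
    T_{m+1}/(x(1-x)); on [0,1] this bounds their values. *)

(** * Positivity and recursion for (p,q)-integers and factorials *)

Section PqAnalogues.
Variable R : realType.
Implicit Types p q x t : R.

Lemma pq_nat_gt0 p q n : 0 < q -> q < p -> (0 < n)%N -> 0 < pq_nat p q n.
Proof.
move=> q0 qp n0; rewrite divr_gt0 ?subr_gt0//.
by rewrite ltr_pXn2r// nnegrE ltW// (lt_trans q0).
Qed.

Lemma pq_nat_ge0 p q n : 0 < q -> q < p -> 0 <= pq_nat p q n.
Proof.
case: n => [|n] q0 qp; first by rewrite /pq_nat subrr mul0r.
exact: ltW (pq_nat_gt0 _ _ _).
Qed.

Lemma pq_fact_gt0 p q n : 0 < q -> q < p -> 0 < pq_fact p q n.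
Proof.
move=> q0 qp; rewrite /pq_fact big_nat_cond; apply: prodr_gt0 => i.
by rewrite andbT => /andP[i0 _]; exact: pq_nat_gt0.
Qed.

Lemma pq_fact0 p q : pq_fact p q 0 = 1.
Proof. by rewrite /pq_fact big_geq. Qed.

Lemma pq_factS p q n : pq_fact p q n.+1 = pq_fact p q n * pq_nat p q n.+1.
Proof. by rewrite /pq_fact big_nat_recr. Qed.

Lemma half_mul_predE n : ((n * n.-1) %/ 2)%N = 'C(n, 2).
Proof. by rewrite bin2 divn2. Qed.

(** * Rescaling from (p,q) to (1,q/p) *)

Lemma pq_nat_scale p q n : 0 < q -> q < p ->
  pq_nat p q n.+1 = p ^+ n * pq_nat 1 (q / p) n.+1.
Proof.
move=> q0 qp; have p0 : 0 < p by exact: lt_trans qp.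
rewrite /pq_nat expr1n expr_div_n !exprS.
field; rewrite ?expf_neq0 ?gt_eqF ?subr_gt0//.
Qed.

Lemma pq_fact_scale p q n : 0 < q -> q < p ->
  pq_fact p q n = p ^+ 'C(n, 2) * pq_fact 1 (q / p) n.
Proof.
move=> q0 qp; elim: n => [|n IH]; first by rewrite !pq_fact0 expr0 mul1r.
by rewrite !pq_factS IH pq_nat_scale// binS bin1 exprD; ring.
Qed.

Lemma prod_scale p q n t x : 0 < p ->
  \prod_(0 <= s < n) (p ^+ s * t - q ^+ s * x) =
  p ^+ 'C(n, 2) * \prod_(0 <= s < n) (t - (q / p) ^+ s * x).
Proof.
move=> p0; elim: n => [|n IH]; first by rewrite !big_geq// expr0 mul1r.
rewrite !big_nat_recr//= IH binS bin1 exprD expr_div_n.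
by field; rewrite expf_neq0 ?gt_eqF.
Qed.

Lemma pq_power_scale p q m t x : 0 < p ->
  pq_power p q m t x = p ^+ 'C(m, 2) * pq_power 1 (q / p) m t x.
Proof.
move=> p0; rewrite /pq_power prod_scale//; congr (_ * _).
by apply: eq_bigr => s _; rewrite expr1n mul1r.
Qed.

(** The exponents of [p] telescope: C(k,2) from the explicit factor, C(n,2) - C(k,2) - C(n-k,2) from
    the binomial coefficient, C(n-k,2) from the product. *)
Lemma pq_basis_scale p q n k x : 0 < q -> q < p ->
  pq_bernstein_basis p q n k x =
  p ^+ 'C(n, 2) * pq_bernstein_basis 1 (q / p) n k x.
Proof.
move=> q0 qp; have p0 : 0 < p by exact: lt_trans qp.
have r0 : 0 < q / p by rewrite divr_gt0.
have r1 : q / p < 1 by rewrite ltr_pdivrMr// mul1r.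
rewrite /pq_bernstein_basis /pq_binom !half_mul_predE expr1n mul1r.
rewrite [\prod_(_ <= s < _) (p ^+ s - _)](_ : _ =
  \prod_(0 <= s < n - k) (p ^+ s * 1 - q ^+ s * x)); last first.
  by apply: eq_bigr => s _; rewrite mulr1.
rewrite prod_scale// (pq_fact_scale n)// (pq_fact_scale k)//.
rewrite (pq_fact_scale (n - k))//.
rewrite [\prod_(_ <= s < _) (1 ^+ s - _)](_ : _ =
  \prod_(0 <= s < n - k) (1 - (q / p) ^+ s * x)); last first.
  by apply: eq_bigr => s _; rewrite expr1n.
have := lt0r_neq0 (pq_fact_gt0 k r0 r1).
have := lt0r_neq0 (pq_fact_gt0 (n - k) r0 r1).
move=> h1 h2; field.
by rewrite h1 h2 !expf_neq0 ?gt_eqF.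
Qed.

Lemma pq_bernstein1E q n f x : pq_bernstein 1 q n f x =
  \sum_(0 <= k < n.+1) f (pq_nat 1 q k / pq_nat 1 q n) *
    pq_bernstein_basis 1 q n k x.
Proof.
rewrite /pq_bernstein expr1n invr1 mul1r.
by apply: eq_bigr => k _; rewrite exp1rz mul1r.
Qed.

Lemma pq_bernstein_scale p q n f x : 0 < q -> q < p ->
  pq_bernstein p q n f x = pq_bernstein 1 (q / p) n f x.
Proof.
move=> q0 qp; have p0 : 0 < p by exact: lt_trans qp.
rewrite pq_bernstein1E /pq_bernstein big_distrr /= [LHS]big_nat [RHS]big_nat.
apply: eq_bigr => k; rewrite ltnS => kn.
rewrite pq_basis_scale// half_mul_predE mulrCA mulKf ?expf_neq0 ?gt_eqF//.
(* The nodes agree: for positive [k] and [n] the powers of [p] cancel as (k-1) - (k-n) - (n-1) = 0,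
   and for [k = 0] both nodes are 0. *)
congr (f _ * _); case: k kn => [|k] kn; first by rewrite /pq_nat !subrr !mul0r.
case: n kn => // n kn.
rewrite (pq_nat_scale k q0 qp) (pq_nat_scale n q0 qp).
have -> : k.+1%:Z - n.+1%:Z = k%:Z - n%:Z by lia.
rewrite expfzDr ?gt_eqF// -exprnP -exprnN.
have r0 : 0 < q / p by rewrite divr_gt0.
have r1 : q / p < 1 by rewrite ltr_pdivrMr// mul1r.
have h := lt0r_neq0 (pq_nat_gt0 r0 r1 (ltn0Sn n)).
by field; rewrite h !expf_neq0 ?gt_eqF.
Qed.


(** * The case p = 1: q-integers and q-powers *)

Section QBernstein.
Variable q : R.
Hypotheses (q0 : 0 < q) (q1 : q < 1).

Local Notation nq := (pq_nat 1 q).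

Lemma q_nat0 : nq 0 = 0.
Proof. by rewrite /pq_nat subrr mul0r. Qed.

Lemma mul1Bq_nat n : (1 - q) * nq n = 1 - q ^+ n.
Proof. by rewrite /pq_nat expr1n mulrC divfK// subr_eq0 gt_eqF. Qed.

Lemma q_natD a b : nq (a + b) = nq a + q ^+ a * nq b.
Proof.
have h : 1 - q != 0 by rewrite subr_eq0 gt_eqF.
by apply: (mulfI h); rewrite mulrDr [X in _ = _ + X]mulrCA !mul1Bq_nat exprD; ring.
Qed.

Lemma q_nat1 : nq 1 = 1.
Proof. by rewrite /pq_nat !expr1 divff// subr_eq0 gt_eqF. Qed.

Lemma q_nat_le n : nq n <= n%:R.
Proof.
elim: n => [|n IH]; first by rewrite q_nat0.
rewrite -addn1 q_natD q_nat1 mulr1 natrD lerD// exprn_ile1// ltW//.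
Qed.

Lemma q_nat_ge1 n : (0 < n)%N -> 1 <= nq n.
Proof.
case: n => // n _; rewrite -add1n q_natD q_nat1 expr1 lerDl mulr_ge0 ?(ltW q0)//.
exact: pq_nat_ge0.
Qed.

Lemma q_power0 t x : pq_power 1 q 0 t x = 1.
Proof. by rewrite /pq_power big_geq. Qed.

Lemma q_power_recl m t x :
  pq_power 1 q m.+1 t x = (t - x) * pq_power 1 q m t (q * x).
Proof.
rewrite /pq_power big_nat_recl//= !expr0 !mul1r; congr (_ * _).
by apply: eq_bigr => s _; rewrite !expr1n exprSr mulrA.
Qed.

Lemma q_power_recr m t x :
  pq_power 1 q m.+1 t x = pq_power 1 q m t x * (t - q ^+ m * x).
Proof. by rewrite /pq_power big_nat_recr//= expr1n mul1r. Qed.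

(** Both powers contain (t - qx)_q^m; the remaining factors are t - q^(m+1) x and t - x. *)
Lemma q_power_diff m t x :
  pq_power 1 q m.+1 t (q * x) - pq_power 1 q m.+1 t x =
  (1 - q ^+ m.+1) * x * pq_power 1 q m t (q * x).
Proof. by rewrite q_power_recr q_power_recl exprS; ring. Qed.

(** * The q-Bernstein basis: q-difference equation and partition of unity *)

Lemma q_basisE n k x : pq_bernstein_basis 1 q n k x =
  pq_binom 1 q n k * x ^+ k * pq_power 1 q (n - k) 1 x.
Proof.
rewrite /pq_bernstein_basis expr1n mul1r; congr (_ * _).
by apply: eq_bigr => s _; rewrite mulr1.
Qed.

(** Moving one factor across the product gives (1 - x) b(qx) = q^k (1 - q^(n-k) x) b(x), and 1 - x -
    q^k + q^n x = (1 - q^k) - (1 - q^n) x. *)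
Lemma q_basis_shift n k x : (k <= n)%N ->
  (1 - x) * (pq_bernstein_basis 1 q n k x - pq_bernstein_basis 1 q n k (q * x))
  = (1 - q) * (nq k - nq n * x) * pq_bernstein_basis 1 q n k x.
Proof.
move=> kn; rewrite !q_basisE.
have e : (1 - x) * pq_power 1 q (n - k) 1 (q * x) =
    pq_power 1 q (n - k) 1 x * (1 - q ^+ (n - k) * x).
  by rewrite -q_power_recl q_power_recr.
rewrite [RHS](_ : _ = ((1 - q) * nq k - (1 - q) * nq n * x) *
  (pq_binom 1 q n k * x ^+ k * pq_power 1 q (n - k) 1 x)); last by ring.
rewrite !mul1Bq_nat -[in q ^+ n](subnK kn) exprD exprMn.
transitivity (pq_binom 1 q n k * x ^+ k * ((1 - x) * pq_power 1 q (n - k) 1 x -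
  q ^+ k * ((1 - x) * pq_power 1 q (n - k) 1 (q * x)))); first by ring.
by rewrite e; ring.
Qed.

Lemma q_fact_neq0 n : pq_fact 1 q n != 0.
Proof. by rewrite lt0r_neq0// pq_fact_gt0. Qed.

Lemma q_binom0 n : pq_binom 1 q n 0 = 1.
Proof. by rewrite /pq_binom pq_fact0 mul1r subn0 divff// q_fact_neq0. Qed.

Lemma q_binomnn n : pq_binom 1 q n n = 1.
Proof. by rewrite /pq_binom subnn pq_fact0 mulr1 divff// q_fact_neq0. Qed.

(** The q-Pascal rule, from the splitting [n+1] = [n-k] + q^(n-k) [k+1]. *)
Lemma q_binomS n k : (k < n)%N -> pq_binom 1 q n.+1 k.+1 =
  pq_binom 1 q n k.+1 + q ^+ (n - k) * pq_binom 1 q n k.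
Proof.
move=> kn; rewrite /pq_binom subSS.
have -> : (n - k = (n - k.+1).+1)%N by lia.
set j := (n - k.+1)%N.
have -> : pq_fact 1 q n.+1 = pq_fact 1 q n * (nq j.+1 + q ^+ j.+1 * nq k.+1).
  by rewrite pq_factS -q_natD; congr (_ * pq_nat _ _ _); lia.
rewrite !(pq_factS _ _ j) !(pq_factS _ _ k).
have hj : nq j.+1 != 0 by rewrite lt0r_neq0// pq_nat_gt0.
have hk : nq k.+1 != 0 by rewrite lt0r_neq0// pq_nat_gt0.
by field; rewrite hj hk !q_fact_neq0.
Qed.

(** By the q-Pascal rule, passing from n to n+1 distributes b_{n,k} over the indices k and k+1 with
    weights 1 - q^(n-k) x and q^(n-k) x, whose sum is 1. *)
Lemma q_basis_sum1 n x : \sum_(0 <= k < n.+1) pq_bernstein_basis 1 q n k x = 1.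
Proof.
elim: n => [|n IH].
  by rewrite big_nat1 q_basisE q_binom0 expr0 q_power0 !mulr1.
pose b k := pq_bernstein_basis 1 q n k x.
have hmid k : (k < n)%N -> pq_bernstein_basis 1 q n.+1 k.+1 x =
    (1 - q ^+ (n - k.+1) * x) * b k.+1 + q ^+ (n - k) * x * b k.
  move=> kn; rewrite /b !q_basisE q_binomS// subSS.
  have -> : (n - k = (n - k.+1).+1)%N by lia.
  by rewrite q_power_recr !exprS; ring.
rewrite big_nat_recr//= big_nat_recl//= big_nat.
rewrite (eq_bigr (fun k => (1 - q ^+ (n - k.+1) * x) * b k.+1 +
  q ^+ (n - k) * x * b k)); last by move=> k /andP[_ kn]; exact: hmid.
rewrite -big_nat big_split /=.
have -> : pq_bernstein_basis 1 q n.+1 0 x = (1 - q ^+ (n - 0) * x) * b 0%N.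
  by rewrite /b !q_basisE !q_binom0 !subn0 q_power_recr; ring.
have -> : pq_bernstein_basis 1 q n.+1 n.+1 x = q ^+ (n - n) * x * b n.
  by rewrite /b !q_basisE !q_binomnn !subnn !q_power0 exprS expr0; ring.
rewrite addrA -(big_nat_recl n 0 (fun k => (1 - q ^+ (n - k) * x) * b k))//.
rewrite -addrA -(big_nat_recr n 0 (fun k => q ^+ (n - k) * x * b k))//=.
by rewrite -big_split /= -[RHS]IH; apply: eq_bigr => k _; rewrite /b; ring.
Qed.

(** * Recurrences for the moments T_m and S_m *)

Definition q_moment n m x :=
  pq_bernstein 1 q n (fun t => pq_power 1 q m t x) x.

(** Only the power is moved to [q * x]; the basis stays at [x], so this is S_m(x) and not
    T_m(qx). *)
Definition q_moment_shift n m x :=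
  pq_bernstein 1 q n (fun t => pq_power 1 q m t (q * x)) x.

Lemma q_moment0 n x : q_moment n 0 x = 1.
Proof.
rewrite /q_moment pq_bernstein1E -[RHS](q_basis_sum1 n x).
by apply: eq_bigr => k _; rewrite q_power0 mul1r.
Qed.

Lemma q_moment_shift0 n x : q_moment_shift n 0 x = 1.
Proof.
rewrite -[RHS](q_moment0 n x) /q_moment /q_moment_shift !pq_bernstein1E.
by apply: eq_bigr => k _; rewrite !q_power0.
Qed.

Lemma q_moment_shiftS n m x : q_moment_shift n m.+1 x =
  q_moment n m.+1 x + (1 - q ^+ m.+1) * x * q_moment_shift n m x.
Proof.
apply/eqP; rewrite addrC -subr_eq; apply/eqP.
rewrite /q_moment /q_moment_shift !pq_bernstein1E -sumrB big_distrr /=.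
by apply: eq_bigr => k _; rewrite -mulrBl q_power_diff -!mulrA.
Qed.

(* [(t - x)(t - q x)_q^m = (t - x)_q^(m+1)], so multiplying the q-difference
   of the basis by [(t - q x)_q^m] raises the moment by one. *)
Lemma q_momentS n m x : (0 < n)%N -> (1 - q) * nq n * q_moment n m.+1 x =
  (1 - x) * (q_moment_shift n m x - q_moment n m (q * x)).
Proof.
move=> n0; have hn : nq n != 0 by rewrite lt0r_neq0// pq_nat_gt0.
rewrite /q_moment /q_moment_shift !pq_bernstein1E -sumrB !big_distrr /=.
rewrite [LHS]big_nat [RHS]big_nat; apply: eq_bigr => k; rewrite ltnS => kn.
rewrite -mulrBr [RHS]mulrCA q_basis_shift// q_power_recl.
by field.
Qed.

Lemma q_moment1 n x : (0 < n)%N -> q_moment n 1 x = 0.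
Proof.
move=> n0; have h : (1 - q) * nq n != 0.
  by rewrite mulf_neq0 ?gt_eqF ?subr_gt0 ?pq_nat_gt0.
apply: (mulfI h).
by rewrite q_momentS// q_moment_shift0 q_moment0 subrr !mulr0.
Qed.

End QBernstein.

End PqAnalogues.

(** * Polynomial functions with bounded coefficients *)

Section CoefficientBounds.
Variable R : realType.
Implicit Types (f g : R -> R) (c : R) (d : nat).

(** Coefficients are bounded rather than values on [0,1], because a q-difference quotient is then
    controlled term by term. The degree is below [d]. *)
Definition poly_bounded d c f : Prop :=
  exists2 P : {poly R}, (size P <= d)%N &
    (forall i, `|P`_i| <= c) /\ forall x, f x = P.[x].

Lemma poly_bounded_ge0 d c f : poly_bounded d c f -> 0 <= c.
Proof. by case=> P _ [/(_ 0%N) h _]; exact: le_trans h. Qed.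

Lemma poly_bounded_le d d' c c' f g : (d <= d')%N -> c <= c' -> f =1 g ->
  poly_bounded d c f -> poly_bounded d' c' g.
Proof.
move=> dd' cc' fg [P sP [cP fP]]; exists P; first exact: leq_trans dd'.
by split=> [i|x]; [exact: le_trans cc' | rewrite -fg].
Qed.

Lemma poly_bounded_cst c : poly_bounded 1 `|c| (fun=> c).
Proof.
exists c%:P; first exact: size_polyC_leq1.
by split=> [i|x]; rewrite ?hornerC// coefC; case: eqP; rewrite ?normr0.
Qed.

Lemma poly_boundedD d c c' f g : poly_bounded d c f -> poly_bounded d c' g ->
  poly_bounded d (c + c') (fun x => f x + g x).
Proof.
move=> [P sP [cP fP]] [Q sQ [cQ gQ]]; exists (P + Q).
  by rewrite (leq_trans (size_polyD _ _))// geq_max sP.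
split=> [i|x]; last by rewrite hornerD fP gQ.
by rewrite coefD (le_trans (ler_normD _ _))// lerD.
Qed.

Lemma poly_boundedZ d c a f : poly_bounded d c f ->
  poly_bounded d (`|a| * c) (fun x => a * f x).
Proof.
move=> [P sP [cP fP]]; exists (a *: P).
  by rewrite (leq_trans (size_scale_leq _ _)).
split=> [i|x]; last by rewrite hornerZ fP.
by rewrite coefZ normrM ler_wpM2l.
Qed.

Lemma poly_boundedMX d c f : poly_bounded d c f ->
  poly_bounded d.+1 c (fun x => x * f x).
Proof.
move=> fb; have c0 := poly_bounded_ge0 fb; case: fb => P sP [cP fP].
exists ('X * P).
  by rewrite (leq_trans (size_polyMleq _ _))// size_polyX addSn add1n ltnS.
split=> [i|x]; last by rewrite hornerM hornerX fP.
by rewrite coefXM; case: eqP; rewrite ?normr0.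
Qed.

Lemma poly_boundedMX1 d c f : poly_bounded d c f ->
  poly_bounded d.+2 (2 * c) (fun x => x * (1 - x) * f x).
Proof.
move=> fb; have c0 := poly_bounded_ge0 fb.
have h1 := poly_boundedMX fb.
have h2 := poly_boundedZ (-1) (poly_boundedMX h1).
have h1' := poly_bounded_le (leqnSn _) (lexx c) (frefl _) h1.
apply: poly_bounded_le (poly_boundedD h1' h2) => //.
  by rewrite normrN1 mul1r; lra.
by move=> x; ring.
Qed.

(** Here [g] is D_q f: it sends x^(i+1) to [i+1] x^i, and [i+1] <= i+1 <= d holds uniformly in [q].
    The product form avoids dividing by [x]. *)
Lemma poly_bounded_qdiff q d c f : 0 < q -> q < 1 -> poly_bounded d c f ->
  exists2 g, poly_bounded d (d%:R * c) g &
    forall x, f x - f (q * x) = (1 - q) * x * g x.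
Proof.
move=> q0 q1 fb; have c0 := poly_bounded_ge0 fb; case: fb => P sP [cP fP].
pose Q := \poly_(i < d) (pq_nat 1 q i.+1 * P`_i.+1).
exists (horner Q).
  exists Q; first exact: size_poly.
  split=> // i; rewrite coef_poly; case: ifP => id; last first.
    by rewrite normr0 mulr_ge0.
  rewrite normrM ler_pM// ger0_norm ?pq_nat_ge0//.
  by rewrite (le_trans (q_nat_le _ _ _))// ler_nat.
(* [P] is padded to [d.+1] terms; once the constant terms cancel, [d] terms remain and match those
   of [Q]. *)
move=> x; rewrite !fP horner_poly !(@horner_coef_wide _ d.+1)// ?leqW//.
rewrite -sumrB big_ord_recl !expr0 subrr add0r big_distrr /=.
apply: eq_bigr => i _; rewrite /bump /= add1n.
transitivity (((1 - q) * pq_nat 1 q i.+1) * P`_i.+1 * x ^+ i.+1).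
  by rewrite mul1Bq_nat// exprMn; ring.
by rewrite exprS; ring.
Qed.

Lemma poly_bounded_norm d c f x : poly_bounded d c f -> 0 <= x -> x <= 1 ->
  `|f x| <= d%:R * c.
Proof.
move=> [P sP [cP ->]] x0 x1; rewrite (horner_coef_wide _ sP).
rewrite (le_trans (ler_norm_sum _ _ _))//.
rewrite -[in d%:R * _](card_ord d) mulr_natl -sumr_const ler_sum// => i _.
rewrite normrM -[c]mulr1 ler_pM// normrX ger0_norm//.
by rewrite exprn_ile1.
Qed.

End CoefficientBounds.

(** * Induction on m for the moment bounds *)

Section MomentBounds.
Variable R : realType.

(** [d] and [C] are chosen before [q] and [n], which makes the final constant uniform. [U] belongs
    to the induction because the next step recovers T_{m+1} from it. *)
Lemma q_moment_bounded m : exists d (C : R), 0 <= C /\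
  forall (q : R) n, 0 < q -> q < 1 -> (0 < n)%N ->
  let e := (pq_nat 1 q n)^-1 in
  [/\ poly_bounded d (C * e ^+ m.+1./2) (q_moment q n m),
      poly_bounded d (C * e ^+ m.+1./2) (q_moment_shift q n m) &
      exists2 U, poly_bounded d (C * e ^+ m.+2./2) U &
        forall x, q_moment q n m.+1 x = x * (1 - x) * U x].
Proof.
elim: m => [|m [d [C [C0 IH]]]].
  exists 1%N, 1; split=> // q n q0 q1 n0 e.
  have e0 : 0 <= e by rewrite invr_ge0 pq_nat_ge0.
  have c1 := poly_bounded_cst (1 : R).
  split.
  - apply: poly_bounded_le c1; rewrite ?normr1 ?mulr1// => x.
    by rewrite q_moment0.
  - apply: poly_bounded_le c1; rewrite ?normr1 ?mulr1// => x.
    by rewrite q_moment_shift0.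
  exists (fun=> 0); last by move=> x; rewrite q_moment1// mulr0.
  apply: poly_bounded_le (poly_bounded_cst 0) => //.
  by rewrite normr0 mul1r exprn_ge0.
(* Multiplying by x(1-x) adds 2 to the size and doubles the coefficients, and D_q then costs [d.+2];
   [m+1] S_m costs m+1. S_{m+1} needs 2 + (m+1), hence [m.+3]. *)
exists d.+2, ((d.+2%:R * 2 + m.+3%:R) * C).
split=> [|q n q0 q1 n0 e]; first by rewrite mulr_ge0// -natrM -natrD ler0n.
have [Tm Sm [U Ub TU]] := IH q n q0 q1 n0.
rewrite -/e in Tm Sm Ub.
have N1 := q_nat_ge1 q0 q1 n0.
have N0 : 0 < pq_nat 1 q n by exact: lt_le_trans N1.
have e0 : 0 <= e by rewrite invr_ge0 ltW.
have e1 : e <= 1 by rewrite invf_le1.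
have qe : 1 - q <= e.
  rewrite -(ler_pM2r N0) mulVf ?gt_eqF// mul1Bq_nat//.
  by rewrite gerBl exprn_ge0// ltW.
have nm := q_nat_le q0 q1 m.+1.
have nm0 : 0 <= pq_nat 1 q m.+1 by exact: pq_nat_ge0.
have Tm1 : poly_bounded d.+2 (2 * (C * e ^+ m./2.+1)) (q_moment q n m.+1).
  by apply: poly_bounded_le (poly_boundedMX1 Ub).
(* For S_{m+1}: the factor 1 - q <= [e] in front of S_m supplies the power of [e] that S_m may
   lack. *)
have hm : e * e ^+ m.+1./2 <= e ^+ m./2.+1.
  by rewrite exprS ler_wpM2l// ler_wiXn2l// half_leq.
have hm' : e ^+ m./2.+1 <= e ^+ m.+1./2.
  by rewrite ler_wiXn2l// (half_leq (leqnSn m.+1)).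
have E0 : 0 <= e ^+ m./2.+1 by rewrite exprn_ge0.
have F0 : 0 <= e ^+ m.+1./2 by rewrite exprn_ge0.
have CE0 := mulr_ge0 C0 E0; have CF0 := mulr_ge0 C0 F0.
have d0 : 0 <= d.+2%:R :> R by rewrite ler0n.
have m0 : 0 <= m.+1%:R :> R by rewrite ler0n.
have m3 : m.+3%:R = m.+1%:R + 2 :> R by rewrite -natrD addn2.
split.
- apply: poly_bounded_le Tm1 => //.
  rewrite mulrA ler_wpM2r// ler_wpM2r// m3; lra.
- have h := poly_boundedZ (1 - q ^+ m.+1) (poly_boundedMX Sm).
  have h' := poly_bounded_le (leqnSn _) (lexx _) (frefl _) h.
  apply: poly_bounded_le (poly_boundedD Tm1 h') => //; last first.
    by move=> x; rewrite q_moment_shiftS// mulrA.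
  have q10 : 0 <= 1 - q by rewrite subr_ge0 ltW.
  rewrite -mul1Bq_nat// ger0_norm ?(mulr_ge0 q10 nm0)//.
  apply: (@le_trans _ _ (2 * (C * e ^+ m./2.+1) +
      m.+1%:R * (C * e ^+ m./2.+1))).
    rewrite lerD2l; apply: (@le_trans _ _ (e * m.+1%:R * (C * e ^+ m.+1./2))).
      by rewrite ler_wpM2r// ler_pM.
    rewrite [leLHS](_ : _ = m.+1%:R * (C * (e * e ^+ m.+1./2))); last by ring.
    by rewrite ler_wpM2l// ler_wpM2l.
  rewrite -mulrDl mulrA ler_wpM2r// ler_wpM2r// m3.
  by rewrite [leLHS]addrC lerDr -natrM ler0n.
(* [V] is D_q T_{m+1}. The next [U] is [e] times V + [m+1] S_m, and this outer [e] raises the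
   exponent from [m.+1./2] to [m.+3./2]. *)
have [V Vb TV] := poly_bounded_qdiff q0 q1 Tm1.
have Sm' := poly_boundedZ (pq_nat 1 q m.+1) Sm.
have Sm2 := poly_bounded_le (leqW (leqnSn _)) (lexx _) (frefl _) Sm'.
exists (fun x => e * (V x + pq_nat 1 q m.+1 * q_moment_shift q n m x)).
  apply: poly_bounded_le (poly_boundedZ e (poly_boundedD Vb Sm2)) => //.
  rewrite !ger0_norm// (exprS e m.+1./2 : e ^+ m.+3./2 = _).
  rewrite [leRHS]mulrCA ler_wpM2l//.
  rewrite m3 [leRHS](_ : _ = d.+2%:R * (2 * (C * e ^+ m.+1./2)) +
    (m.+1%:R * (C * e ^+ m.+1./2) + 2 * (C * e ^+ m.+1./2))); last by ring.
  rewrite lerD// ?ler_wpM2l//.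
  by apply: ler_wpDr; [rewrite mulr_ge0 | exact: ler_wpM2r].
move=> x; have h : (1 - q) * pq_nat 1 q n != 0.
  by rewrite mulf_neq0 ?gt_eqF// subr_gt0.
(* Both parts of S_{m+1}(x) - T_{m+1}(qx) carry (1-q)x: the factor 1-q cancels, and x joins 1-x. *)
apply: (mulfI h); rewrite q_momentS// q_moment_shiftS//.
rewrite -addrAC TV -mul1Bq_nat// /e.
by field; rewrite gt_eqF.
Qed.

Lemma pq_nat_le_q_nat (p q : R) n : 0 < q -> q < p -> p <= 1 ->
  pq_nat p q n <= pq_nat 1 (q / p) n.
Proof.
move=> q0 qp p1; have p0 : 0 < p by exact: lt_trans qp.
have r0 : 0 < q / p by rewrite divr_gt0.
have r1 : q / p < 1 by rewrite ltr_pdivrMr// mul1r.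
case: n => [|n]; first by rewrite !q_nat0 /pq_nat subrr mul0r.
rewrite pq_nat_scale// ler_piMl ?pq_nat_ge0//.
by rewrite exprn_ile1// ltW.
Qed.

End MomentBounds.

Theorem theorem2p4 (R : realType) (m : nat) (hm : (0 < m)%N) :
  exists C : R, 0 < C /\
    forall (p q : R), 0 < q -> q < p -> p <= 1 ->
    forall (n : nat), (0 < n)%N ->
    forall (x : R), 0 <= x -> x <= 1 ->
      `|pq_bernstein p q n (fun t : R => pq_power p q m t x) x|
        <= C * (x * (1 - x) / pq_nat p q n ^+ ((m + 1) %/ 2)).
Proof.
(* For exponent m+1 the factor [U] at index [m] is used; its power [m.+2./2] is the required one. *)
case: m hm => // m _.
have [d [C [C0 H]]] := q_moment_bounded R m.
(* [d%:R * C] bounds [U] on [0,1] up to the power of [n]; the 1 makes the constant positive. *)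
exists (d%:R * C + 1); split=> [|p q q0 qp p1 n n0 x x0 x1].
  by rewrite ltr_pwDr// mulr_ge0.
have p0 : 0 < p by exact: lt_trans qp.
have r0 : 0 < q / p by rewrite divr_gt0.
have r1 : q / p < 1 by rewrite ltr_pdivrMr// mul1r.
have [_ _ [U Ub TU]] := H _ n r0 r1 n0.
have hx : 0 <= x * (1 - x) by rewrite mulr_ge0// subr_ge0.
rewrite addn1 divn2 mulrCA.
have -> : pq_bernstein p q n (fun t => pq_power p q m.+1 t x) x =
    p ^+ 'C(m.+1, 2) * q_moment (q / p) n m.+1 x.
  rewrite pq_bernstein_scale// /q_moment !pq_bernstein1E big_distrr /=.
  by apply: eq_bigr => k _; rewrite pq_power_scale// mulrA.
rewrite normrM TU normrM (ger0_norm hx) ger0_norm ?exprn_ge0 ?(ltW p0)//.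
apply: (@le_trans _ _ (x * (1 - x) * `|U x|)).
  by apply: ler_piMl; [rewrite mulr_ge0 | rewrite exprn_ile1// ltW].
rewrite ler_wpM2l// (le_trans (poly_bounded_norm Ub x0 x1))//.
rewrite mulrA ler_pM ?mulr_ge0 ?exprn_ge0 ?invr_ge0 ?pq_nat_ge0//.
  by rewrite lerDl.
rewrite exprVn lef_pV2 ?posrE ?exprn_gt0 ?pq_nat_gt0//.
by rewrite lerXn2r ?nnegrE ?pq_nat_ge0// pq_nat_le_q_nat.
Qed.
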